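(* Let $f\in\mathbb{R}[x,y]$ be an admissible polynomial which is not a square in $\mathbb{R}[x,y]$, and let $s\ge1$ be an integer. Then $p_{2s}\big(\mathbb{R}[x,y,\sqrt{f(x,y)}]\big)=\infty$.
   Context: $\mathbb{R}[x,y,\sqrt{f}]$ denotes the ring $\mathbb{R}[x,y,z]/(z^2-f(x,y))$. Let $f\in\mathbb{R}[x,y]$ be non-constant with $f(0,0)=0$; let $d=\deg_y f$ and let $\alpha x^b y^d$ be the monomial of $f$ with nonzero coefficient $\alpha$ having $y$-degree $d$ and the largest possible $b$. Then $f$ is strictly admissible if either (a) $\alpha>0$ and $b,d$ are both even, or (b) $b$ or $d$ is odd. A polynomial $f$ is admissible if there is $M\in\mathrm{GL}_2(\mathbb{R})$ such that $f\circ M$ is strictly admissible. For a commutative ring $A$ with identity and a positive integer $m$, the $m$-th Pythagoras number $p_m(A)$ is the least positive integer $\ell$ such that every element of $A$ that is a sum of $m$-th powers of elements of $A$ can be written as a sum of at most $\ell$ $m$-th powers of elements of $A$; if no such $\ell$ exists, $p_m(A)=\infty$. *)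

(* Defs.v *)
From HB Require Import structures.
From mathcomp Require Import all_boot all_order all_algebra.
From mathcomp Require Import reals.
Set Implicit Arguments. Unset Strict Implicit. Unset Printing Implicit Defensive.
Import Order.TTheory GRing.Theory Num.Theory.
Local Open Scope ring_scope.

Section Defs.
Variable R : realType.

(* Bivariate polynomials R[x,y] are encoded as {poly {poly R}}:
   the outer variable is y, the inner variable is x.                   *)
Definition bipoly := {poly {poly R}}.
Definition xP : bipoly := ('X : {poly R})%:P.
Definition yP : bipoly := 'X.
Definition cstP (c : R) : bipoly := c%:P%:P.

Definition eval00 (f : bipoly) : R := (f.[0]).[0].

Definition compM (f : bipoly) (M : 'M[R]_2) : bipoly :=
  let L1 := cstP (M 0 0) * xP + cstP (M 0 1) * yP in
  let L2 := cstP (M 1 0) * xP + cstP (M 1 1) * yP in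
  (map_poly (fun q : {poly R} => (map_poly cstP q).[L1]) f).[L2].

(* d = deg_y f ; alpha x^b y^d the monomial of y-degree d with largest b *)
Definition degy (f : bipoly) : nat := (size f).-1.
Definition bexp (f : bipoly) : nat := (size (lead_coef f)).-1.
Definition alpha (f : bipoly) : R := lead_coef (lead_coef f).

Definition nonconstant (f : bipoly) : Prop := ~ exists c : R, f = cstP c.

Definition strictly_admissible (f : bipoly) : Prop :=
  nonconstant f /\ eval00 f = 0 /\
  ((0 < alpha f /\ ~~ odd (bexp f) /\ ~~ odd (degy f))
   \/ odd (bexp f) \/ odd (degy f)).

Definition admissible (f : bipoly) : Prop :=
  exists M : 'M[R]_2, M \in unitmx /\ strictly_admissible (compM f M).

(* The ring R[x,y,sqrt f] = R[x,y,z]/(z^2 - f): elements are represented by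
   trivariate polynomials {poly bipoly} (outer variable z), and two
   representatives are equal in the quotient iff their difference lies in
   the ideal generated by z^2 - f.                                       *)
Definition tripoly := {poly bipoly}.
Definition eq_mod_sqrt (f : bipoly) (p q : tripoly) : Prop :=
  exists h : tripoly, p - q = h * ('X ^+ 2 - f%:P).

Definition sum_of_powers (f : bipoly) (m : nat) (p : tripoly) : Prop :=
  exists s : seq tripoly, eq_mod_sqrt f p (\sum_(a <- s) a ^+ m).

Definition sum_of_at_most_powers (f : bipoly) (m l : nat) (p : tripoly) : Prop :=
  exists s : seq tripoly, (size s <= l)%N /\ eq_mod_sqrt f p (\sum_(a <- s) a ^+ m).

Definition pythagoras_infinite (f : bipoly) (m : nat) : Prop :=
  ~ exists l : nat, (0 < l)%N /\
      forall p : tripoly, sum_of_powers f m p -> sum_of_at_most_powers f m l p.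

End Defs.

(* Main.v *)
Require Import Defs.
From HB Require Import structures.
From mathcomp Require Import all_boot all_order all_algebra.
From mathcomp Require Import reals.
From mathcomp Require Import polyrcf.
From mathcomp Require Import ring lra zify.
Set Implicit Arguments. Unset Strict Implicit. Unset Printing Implicit Defensive.
Import Order.TTheory GRing.Theory Num.Theory.
Local Open Scope ring_scope.

(** After the substitution M, put G_0 = 0 and G_(n+1) = 1 + p^(2s) G_n with
    p = y - c x^N, c = 1 or -1, and N very large compared with G_n. If
    G_(n+1) = \sum_j h_j^(2s) in R[x,y,sqrt F], then on the curve p = 0 each h_j is
    bounded where F tends to +oo, which is where admissibility enters; so h_j is a
    constant c_j there and h_j = c_j + p k_j. On the curves y = u x^N0, with N0
    fixed before N, the k_j have degree small compared with N, so both sides may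
    be compared digit by digit in base p: \sum_j c_j^(2s-1) k_j = 0,
    \sum_j c_j^(2s) = 1 and \sum_j k_j^(2s) = G_n. Hence every linear relation
    between the h_j holds between the k_j, which satisfy one more relation. The
    relations between the summands of a representation of G_n thus have
    codimension at least n, and any representation of G_n needs n summands.

    The two square roots of F are handled by evaluating a + b sqrt F at real points
    of v^2 = F(x,y). The signs sg and ta select a quadrant at infinity on which F
    is positive. *)

(** * Growth at infinity and base-[p] digits in one variable *)

Definition eventually {R : numDomainType} (P : R -> Prop) :=
  exists M, forall t, M <= t -> P t.

Section Growth.
Variable R : rcfType.
Implicit Types P Q : {poly R}.

Lemma eventually_gt0 P : 0 < lead_coef P ->
  eventually (fun t => 0 < P.[t]).
Proof.
move=> lc; have [n Hn] := poly_pinfty_gt_lc lc.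
by exists n => t nt; apply: lt_le_trans lc (Hn _ nt).
Qed.

(** If [Q] had smaller degree, [P - Q] would keep the positive leading coefficient of [P] and be
    eventually positive. *)
Lemma size_le_of_eventually_le P Q : 0 < lead_coef P ->
  eventually (fun t => P.[t] <= Q.[t]) -> (size P <= size Q)%N.
Proof.
move=> lc [M HM]; rewrite leqNgt; apply/negP => ltQP.
have: 0 < lead_coef (P - Q) by rewrite lead_coefDl // size_polyN.
move=> /eventually_gt0 [M' HM'].
have := HM' (Num.max M M'); have := HM (Num.max M M').
rewrite !le_max !lexx orbT hornerD hornerN => /(_ isT) H1 /(_ isT) H2.
lra.
Qed.

Lemma poly_eq0_of_eventually P : eventually (fun t => P.[t] = 0) -> P = 0.
Proof.
move=> [M HM]; apply/eqP/negPn/negP => P0.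
have lc : 0 < lead_coef (P ^+ 2).
  by rewrite lead_coef_exp exprn_even_gt0 //= lead_coef_eq0.
have [M' HM'] := eventually_gt0 lc.
have := HM' (Num.max M M'); have := HM (Num.max M M').
rewrite !le_max !lexx orbT horner_exp => /(_ isT) -> /(_ isT).
by rewrite expr0n ltxx.
Qed.

(** Applied to [a + v b] and [a - v b] with [v] a square root of [F], this bounds [a] and [v b]
    separately. Both half-combinations have absolute value at most the larger of [|x|] and [|y|],
    and even powers are monotone in the absolute value. *)
Lemma expr_half_le (s : nat) (x y g : R) :
  x ^+ (2 * s) <= g -> y ^+ (2 * s) <= g ->
  ((x + y) / 2) ^+ (2 * s) <= g /\ ((x - y) / 2) ^+ (2 * s) <= g.
Proof.
have E (z : R) : z ^+ (2 * s) = `|z| ^+ (2 * s).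
  by rewrite -normrX ger0_norm // exprn_even_ge0 // oddM.
move=> hx hy.
suff H (z : R) : `|z| <= `|x| \/ `|z| <= `|y| -> z ^+ (2 * s) <= g.
  have nx := ler_norm x; have nx' := ler_norm (- x).
  have ny := ler_norm y; have ny' := ler_norm (- y).
  rewrite !normrN in nx' ny'.
  by split; apply: H; case: (leP `|x| `|y|) => hxy; [right|left|right|left];
     rewrite ler_norml; apply/andP; split; lra.
rewrite E => -[] h; [apply: le_trans hx | apply: le_trans hy];
  by rewrite [leRHS]E; apply: lerXn2r => //; rewrite nnegrE.
Qed.

Lemma size_exp_mul_le P (m n : nat) :
  P != 0 -> (size (P ^+ m) <= n)%N -> (m * (size P).-1 < n)%N.
Proof.
move=> P0; have := size_exp P m.
have : P ^+ m != 0 by rewrite expf_neq0.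
rewrite -size_poly_gt0; case: (size (P ^+ m)) => //= k _ ->.
by rewrite mulnC.
Qed.

(** Uniqueness of base-[p] digits: the lowest digit is a multiple of [p] of smaller degree than [p],
    hence zero, and the other digits again sum to zero after division by [p]. *)
Lemma digits_eq0 (p : {poly R}) (e : nat -> {poly R}) (M : nat) :
  (forall m, (m < M)%N -> (size (e m) < size p)%N) ->
  \sum_(m < M) p ^+ m * e m = 0 -> forall m, (m < M)%N -> e m = 0.
Proof.
elim: M e => // M IH e small.
rewrite big_ord_recl expr0 mul1r.
under eq_bigr => i _ do rewrite lift0 exprS -mulrA.
rewrite -mulr_sumr; set S := (X in p * X) => Hs.
have s0 := small 0%N isT.
have p0 : p != 0 by rewrite -size_poly_gt0 (leq_ltn_trans _ s0).
have S0 : S = 0.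
  apply/eqP/negPn/negP => S0.
  move: s0; rewrite ltnNge => /negP; apply.
  move/eqP: Hs; rewrite addr_eq0 => /eqP ->.
  rewrite size_polyN size_mul //; move: S0; rewrite -size_poly_gt0.
  by case: (size S) => // k _; rewrite addnS leq_addr.
move: Hs; rewrite S0 mulr0 addr0 => e0 [|m] // mM.
by apply: (IH (fun m => e m.+1)) => // k kM; apply: small.
Qed.

End Growth.

(** * Restriction to monomial curves *)

Section Curves.
Variable R : rcfType.
Local Notation B := {poly {poly R}}.
Implicit Types a F : B.

Definition eval2 a (x y : R) : R := (a.[y%:P]).[x].

Lemma horner_horner a (q : {poly R}) (x : R) : (a.[q]).[x] = eval2 a x q.[x].
Proof.
rewrite /eval2; elim/poly_ind: a => [|a c IH]; first by rewrite !horner0.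
by rewrite !hornerMXaddC hornerD hornerM IH !(hornerD, hornerM, hornerC).
Qed.

Lemma eval2_const (c x y : R) : eval2 (c%:P%:P) x y = c.
Proof. by rewrite /eval2 !hornerC. Qed.

(** As a polynomial in [y] over the domain [R[x]], [Q] has [size Q] distinct roots, from
    [u = 1, 2, ...], more than its degree allows. *)
Lemma poly_eq0_of_monomial_curves (N : nat) (w : R) (Q : B) : w != 0 ->
  (forall u, 0 < u -> Q.[(w * u) *: 'X^N] = 0) -> Q = 0.
Proof.
move=> w0 HQ.
pose rs := [seq (w * i.+1%:R) *: 'X^N : {poly R} | i <- iota 0 (size Q)].
apply: (@roots_geq_poly_eq0 _ Q rs).
- by apply/allP => q /mapP [i _ ->]; rewrite /root HQ // ltr0n.
- rewrite map_inj_uniq ?iota_uniq // => i j /(congr1 (fun q : {poly R} => q`_N)).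
  rewrite !coefZ !coefXn eqxx !mulr1 => /(mulfI w0) /eqP.
  by rewrite eqr_nat eqSS => /eqP.
- by rewrite size_map size_iota.
Qed.

Variables sg ta : R.
Hypotheses (sg2 : sg * sg = 1) (ta2 : ta * ta = 1).

(* Restriction to the curve t |-> (sg t, ta u t^N). *)
Definition on_curve (N : nat) (u : R) (a : B) : {poly R} :=
  (a.[(ta * sg ^+ N * u) *: 'X^N]) \Po (sg *: 'X).

Lemma sg_neq0 : sg != 0.
Proof. by apply/eqP => h; move: sg2; rewrite h mul0r => /esym/eqP; rewrite oner_eq0. Qed.
Lemma ta_neq0 : ta != 0.
Proof. by apply/eqP => h; move: ta2; rewrite h mul0r => /esym/eqP; rewrite oner_eq0. Qed.

Lemma sgX2 N : sg ^+ N * sg ^+ N = 1.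
Proof. by rewrite -exprMn sg2 expr1n. Qed.

Lemma size_sgX : size (sg *: 'X : {poly R}) = 2.
Proof. by rewrite size_scale ?size_polyX // sg_neq0. Qed.

Lemma on_curveD N u a b : on_curve N u (a + b) = on_curve N u a + on_curve N u b.
Proof. by rewrite /on_curve hornerD comp_polyD. Qed.
Lemma on_curveB N u a b : on_curve N u (a - b) = on_curve N u a - on_curve N u b.
Proof. by rewrite /on_curve hornerD hornerN comp_polyB. Qed.
Lemma on_curveM N u a b : on_curve N u (a * b) = on_curve N u a * on_curve N u b.
Proof. by rewrite /on_curve hornerM comp_polyM. Qed.
Lemma on_curveX N u a n : on_curve N u (a ^+ n) = on_curve N u a ^+ n.
Proof. by rewrite /on_curve horner_exp rmorphXn. Qed.
Lemma on_curveC N u (c : R) : on_curve N u (c%:P%:P) = c%:P.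
Proof. by rewrite /on_curve hornerC comp_polyC. Qed.
Lemma on_curve0 N u : on_curve N u 0 = 0.
Proof. by rewrite /on_curve horner0 comp_poly0. Qed.
Lemma on_curve1 N u : on_curve N u 1 = 1.
Proof. exact: on_curveC. Qed.
Lemma on_curve_sum N u (I : finType) (f : I -> B) :
  on_curve N u (\sum_i f i) = \sum_i on_curve N u (f i).
Proof. exact: (big_morph (on_curve N u) (on_curveD N u) (on_curve0 N u)). Qed.

(** The factor [sg ^+ N] in the curve cancels the one from [(sg * t) ^+ N], so the quadrant does not
    depend on the parity of [N]. *)
Lemma horner_on_curve N u a (t : R) :
  (on_curve N u a).[t] = eval2 a (sg * t) (ta * u * t ^+ N).
Proof.
rewrite /on_curve horner_comp !hornerE horner_horner; congr eval2.
rewrite !hornerE exprMn.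
have := sgX2 N; set z := sg ^+ N => h.
by transitivity (ta * u * t ^+ N * (z * z)); [ring | rewrite h mulr1].
Qed.

Lemma on_curve_injective N a :
  (forall u, 0 < u -> on_curve N u a = 0) -> a = 0.
Proof.
move=> h; apply: (@poly_eq0_of_monomial_curves N (ta * sg ^+ N)).
  by rewrite mulf_neq0 ?ta_neq0 ?expf_neq0 ?sg_neq0.
move=> u u0; apply/eqP; rewrite -size_poly_eq0.
by rewrite -(@size_comp_poly2 _ _ (sg *: 'X)) ?size_sgX // size_poly_eq0 [X in X == 0]h.
Qed.

(** The bound has to be uniform in [u]: the exponent of the next curve is chosen from it before [u]
    varies. *)
Lemma size_on_curve_bounded N a : exists g, forall u, (size (on_curve N u a) <= g)%N.
Proof.
rewrite /on_curve.
suff [g Hg] : exists g, forall w : R, (size (a.[w *: 'X^N]) <= g)%N.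
  by exists g => u; rewrite size_comp_poly2 ?size_sgX // Hg.
elim/poly_ind: a => [|a c [g Hg]]; first by exists 0%N => w; rewrite horner0 size_poly0.
exists (maxn (g + N.+1) (size c)) => w; rewrite hornerMXaddC.
apply: leq_trans (size_polyD _ _) _; rewrite geq_max leq_max leq_maxr andbT.
apply/orP; left; apply: leq_trans (size_polyMleq _ _) _.
have := Hg w; have : (size (w *: 'X^N : {poly R}) <= N.+1)%N.
  by apply: leq_trans (size_scale_leq _ _) _; rewrite size_polyXn.
lia.
Qed.

(* The polynomial p of the construction; its zero set is the curve u = 1. *)
Definition curve_eq (N : nat) : B := 'X - ((ta * sg ^+ N) *: 'X^N)%:P.

Lemma on_curve_curve_eq N : on_curve N 1 (curve_eq N) = 0.
Proof. by rewrite /on_curve mulr1 !hornerE subrr comp_poly0. Qed.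

Lemma on_curve_curve_eqE N0 N u :
  on_curve N0 u (curve_eq N) = (ta * u) *: 'X^N0 - ta *: 'X^N.
Proof.
rewrite /on_curve !hornerE comp_polyB !comp_polyZ !comp_Xn_poly !exprZn !scalerA.
congr (_ *: _ - _ *: _).
  transitivity (ta * u * (sg ^+ N0 * sg ^+ N0)); first ring.
  by rewrite sgX2 mulr1.
by rewrite -mulrA sgX2 mulr1.
Qed.

Lemma size_on_curve_curve_eq N0 N u : (N0 < N)%N ->
  size (on_curve N0 u (curve_eq N)) = N.+1.
Proof.
move=> h; rewrite on_curve_curve_eqE addrC.
have sN : size (- (ta *: 'X^N) : {poly R}) = N.+1.
  by rewrite size_polyN size_scale ?ta_neq0 // size_polyXn.
rewrite size_polyDl sN //.
by apply: leq_ltn_trans (size_scale_leq _ _) _; rewrite size_polyXn ltnS.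
Qed.

(** Substituting [sg *: 'X] is an involution; undoing it shows that [w] is a root in [y] of [a - c],
    and the factor theorem applies. *)
Lemma curve_eq_dvd N a (c : R) : on_curve N 1 a = c%:P ->
  exists q, a = c%:P%:P + curve_eq N * q.
Proof.
rewrite /on_curve mulr1; set w := _ *: 'X^N => h.
have: root (a - c%:P%:P) w.
  rewrite /root !hornerE subr_eq0; apply/eqP.
  have := congr1 (fun q => q \Po (sg *: 'X)) h.
  by rewrite -comp_polyA comp_polyZ comp_polyX scalerA sg2 scale1r comp_polyXr comp_polyC.
by move/factor_theorem => [q Hq]; exists q; rewrite -[LHS](subrK c%:P%:P) Hq addrC mulrC.
Qed.

Variable F : B.
Hypothesis F_nonconst : ~ exists c : R, F = c%:P%:P.
Hypothesis F_lead :
  0 < lead_coef (lead_coef F) * sg ^+ (size (lead_coef F)).-1 * ta ^+ (size F).-1.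

(* Along y = u x^N with N large, the monomial alpha x^b y^d dominates F. *)
Lemma on_curve_leading : exists N0, forall N u, (N0 <= N)%N -> 0 < u ->
  0 < lead_coef (on_curve N u F) /\ (1 < size (on_curve N u F))%N.
Proof.
(* [S] bounds the x-size of every coefficient, so for [N > S] one more power of [y] outweighs any
   power of [x]. *)
pose S := \max_(i < size F) size (F`_i)%R.
exists S.+1 => N u SN u0.
have F0 : F != 0.
  by apply/eqP => h; apply: F_nonconst; exists 0; rewrite h.
have l0 : lead_coef F != 0 by rewrite lead_coef_eq0.
set w := ta * sg ^+ N * u.
have w0 : w != 0.
  by rewrite !mulf_neq0 ?ta_neq0 ?expf_neq0 ?sg_neq0 ?gt_eqF.
have FL := F_lead; set d := (size F).-1 in FL *.
set b := (size (lead_coef F)).-1 in FL *.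
have sF : size F = d.+1 by rewrite /d prednK // size_poly_gt0.
have sl : size (lead_coef F) = b.+1 by rewrite /b prednK // size_poly_gt0.
have q0 : w *: 'X^N != 0 :> {poly R} by rewrite scaler_eq0 negb_or w0 monic_neq0 // monicXn.
have stop : size (lead_coef F * (w *: 'X^N) ^+ d) = (b + d * N).+1.
  rewrite exprZn -exprM -scalerAr size_scale ?expf_neq0 //.
  by rewrite size_mulXn // sl mulnC addnS addnC.
have ltop : lead_coef (lead_coef F * (w *: 'X^N) ^+ d) = lead_coef (lead_coef F) * w ^+ d.
  by rewrite lead_coefM lead_coef_exp lead_coefZ lead_coefXn mulr1.
have slow : (size (\sum_(i < d) F`_i * (w *: 'X^N) ^+ i)%R < (b + d * N).+1)%N.
  apply: leq_ltn_trans (size_sum _ _ _) _; rewrite ltnS.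
  apply/bigmax_leqP => i _.
  apply: leq_trans (size_polyMleq _ _) _.
  have h1 : (size (F`_i)%R <= S)%N.
    have hi : (i < size F)%N by rewrite sF ltnW // ltnS.
    exact: (@leq_bigmax _ (fun i : 'I_(size F) => size (F`_i)%R) (Ordinal hi)).
  have h2 : (size ((w *: 'X^N) ^+ i : {poly R})%R <= (i * N).+1)%N.
    rewrite exprZn -exprM; apply: leq_trans (size_scale_leq _ _) _.
    by rewrite size_polyXn mulnC.
  have h3 : (i.+1 * N <= d * N)%N by rewrite leq_mul2r ltn_ord orbT.
  rewrite mulSn in h3; move: h1 h2 h3 SN; clear; lia.
have E : F.[w *: 'X^N] = lead_coef F * (w *: 'X^N) ^+ d +
     \sum_(i < d) F`_i * (w *: 'X^N) ^+ i.
  by rewrite horner_coef sF big_ord_recr /= addrC lead_coefE sF.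
have sE : size F.[w *: 'X^N] = (b + d * N).+1.
  by rewrite E size_polyDl stop.
split; last first.
  rewrite size_comp_poly2 ?size_sgX // sE ltnS addn_gt0 muln_gt0.
  (* As [N > 0], a zero degree [b + d * N] would force [b = d = 0] and [F] constant. *)
  rewrite (leq_trans _ SN) // andbT !lt0n -negb_and; apply/negP => /andP [/eqP b0 /eqP d0].
  apply: F_nonconst; exists F`_0`_0.
  rewrite {1}(size1_polyC (_ : (size F <= 1)%N)) ?sF ?d0 //; congr _%:P.
  by apply: size1_polyC; move: sl; rewrite b0 lead_coefE sF d0 => ->.
rewrite lead_coef_comp ?size_sgX // sE E lead_coefDl ?stop // ltop.
rewrite lead_coefZ lead_coefX mulr1 /= /w.
(* The sign [sg ^+ (N * d)] occurs twice, from the curve and from substituting [sg *: 'X], so it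
   cancels. *)
have -> : lead_coef (lead_coef F) * (ta * sg ^+ N * u) ^+ d * sg ^+ (b + d * N)
   = (lead_coef (lead_coef F) * sg ^+ b * ta ^+ d) * u ^+ d * (sg ^+ (N * d) * sg ^+ (N * d)).
  by rewrite !exprMn exprD -exprM (mulnC d N); ring.
by rewrite sgX2 mulr1 mulr_gt0 // exprn_gt0.
Qed.

End Curves.

(* [lia] fails on sizes of polynomials unless they are made opaque. *)
Ltac hide_sizes := repeat match goal with
  |- context [@size ?T ?x] => move: (@size T x) => ? end.
Ltac size_lia := hide_sizes; lia.
Ltac size_nia := hide_sizes; nia.

(** * Representations by powers and the comparison of digits *)

Section Step.
Variable R : rcfType.
Local Notation B := {poly {poly R}}.
Implicit Types F G : B.

Lemma eval2D (a b : B) x y : eval2 (a + b) x y = eval2 a x y + eval2 b x y.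
Proof. by rewrite /eval2 !hornerD. Qed.
Lemma eval2N (a : B) x y : eval2 (- a) x y = - eval2 a x y.
Proof. by rewrite /eval2 !hornerN. Qed.
Lemma eval2B (a b : B) x y : eval2 (a - b) x y = eval2 a x y - eval2 b x y.
Proof. by rewrite eval2D eval2N. Qed.
Lemma eval2M (a b : B) x y : eval2 (a * b) x y = eval2 a x y * eval2 b x y.
Proof. by rewrite /eval2 !hornerM. Qed.
Lemma eval2X (a : B) n x y : eval2 (a ^+ n) x y = eval2 a x y ^+ n.
Proof. by rewrite /eval2 !horner_exp. Qed.
Lemma eval2_sum (I : Type) (r : seq I) (f : I -> B) x y :
  eval2 (\sum_(i <- r) f i) x y = \sum_(i <- r) eval2 (f i) x y.
Proof. by rewrite /eval2 !horner_sum. Qed.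

(* [sqrt_power_sum F m l a b G]: G = \sum_j (a_j + b_j sqrt F)^m as functions on
   the real points of v^2 = F(x,y). *)
Definition sqrt_power_sum F (m l : nat) (a b : 'I_l -> B) G :=
  forall x y v, v ^+ 2 = eval2 F x y ->
    \sum_j (eval2 (a j) x y + v * eval2 (b j) x y) ^+ m = eval2 G x y.

(* The powers of a + b sqrt F, as pairs of coefficients. *)
Fixpoint sqrt_pow F (a b : B) (m : nat) : B * B :=
  if m is m'.+1 then
    let: (c, d) := sqrt_pow F a b m' in (a * c + F * (b * d), a * d + b * c)
  else (1, 0).

Lemma eval2_sqrt_pow F a b m x y v : v ^+ 2 = eval2 F x y ->
  eval2 (sqrt_pow F a b m).1 x y + v * eval2 (sqrt_pow F a b m).2 x y =
  (eval2 a x y + v * eval2 b x y) ^+ m.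
Proof.
move=> hv; elim: m => [|m /= IH].
  by rewrite /eval2 !hornerE.
rewrite exprS -IH; case: (sqrt_pow F a b m) => c d /=.
rewrite !(eval2D, eval2M) -hv; ring.
Qed.

Variables sg ta : R.
Hypotheses (sg2 : sg * sg = 1) (ta2 : ta * ta = 1).
Local Notation oc := (on_curve sg ta).

Lemma size_on_curve_sqrt_pow F a b m N u g e :
  (size (oc N u a) <= g)%N -> (size (oc N u b) <= g)%N -> (size (oc N u F) <= e)%N ->
  (size (oc N u (sqrt_pow F a b m).1) <= m * (g + e) + 1)%N /\
  (size (oc N u (sqrt_pow F a b m).2) <= m * (g + e) + 1)%N.
Proof.
move=> ha hb hF; elim: m => [|m /=].
  by rewrite /= on_curve1 on_curve0 size_poly1 size_poly0.
case: (sqrt_pow F a b m) => c d /= [hc hd].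
rewrite !(on_curveD, on_curveM) mulSn; move: (m * (g + e))%N hc hd => K hc hd.
split; apply: leq_trans (size_polyD _ _) _; rewrite geq_max; apply/andP; split;
 apply: leq_trans (size_polyMleq _ _) _.
- by move: ha hc; size_lia.
- have : (size (oc N u b * oc N u d)%R <= g + (K + 1))%N.
    by apply: leq_trans (size_polyMleq _ _) _; move: hb hd; size_lia.
  by move: hF; size_lia.
- by move: ha hd; size_lia.
- by move: hb hc; size_lia.
Qed.

Variable F : B.
Variable s : nat.
Hypothesis s_gt0 : (0 < s)%N.

Lemma lead_coef_even_power (P : {poly R}) : P != 0 -> 0 < lead_coef (P ^+ (2 * s)).
Proof.
by move=> P0; rewrite lead_coef_exp exprn_even_gt0 ?lead_coef_eq0 ?P0 ?orbT // oddM.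
Qed.

(** Where [F > 0], both roots [v] and [- v] are real and each summand is at most [G], the others
    being nonnegative. Hence so are the powers of [a_j] and [v b_j], and pointwise bounds give
    degree bounds. *)
Lemma size_components_le l (a b : 'I_l -> B) G N u :
  sqrt_power_sum F (2 * s) a b G -> 0 < lead_coef (oc N u F) -> forall j,
  (size (oc N u (a j) ^+ (2 * s)) <= size (oc N u G))%N /\
  (size (oc N u (b j) ^+ (2 * s) * oc N u F ^+ s)%R <= size (oc N u G))%N.
Proof.
move=> H lF j; have [M HM] := eventually_gt0 lF.
have main t : M <= t ->
   (oc N u (a j)).[t] ^+ (2 * s) <= (oc N u G).[t] /\
   (oc N u (b j)).[t] ^+ (2 * s) * (oc N u F).[t] ^+ s <= (oc N u G).[t].
  move=> /HM; rewrite !horner_on_curve //.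
  set x := sg * t; set y := ta * u * t ^+ N => F0.
  have part v : v ^+ 2 = eval2 F x y ->
    (eval2 (a j) x y + v * eval2 (b j) x y) ^+ (2 * s) <= eval2 G x y.
    move=> /H <-; rewrite (bigD1 j) //= lerDl sumr_ge0 // => i _.
    by rewrite exprn_even_ge0 // oddM.
  pose v := Num.sqrt (eval2 F x y).
  have hv : v ^+ 2 = eval2 F x y by rewrite sqr_sqrtr // ltW.
  have hv' : (- v) ^+ 2 = eval2 F x y by rewrite sqrrN.
  have [] := expr_half_le (part _ hv) (part _ hv').
  rewrite -hv -exprM -exprMn.
  set A := eval2 (a j) x y; set C := eval2 (b j) x y.
  have -> : (A + v * C + (A + - v * C)) / 2 = A by field.
  have -> : (A + v * C - (A + - v * C)) / 2 = C * v by field.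
  by rewrite !exprMn.
split.
  have [->|n0] := eqVneq (oc N u (a j)) 0.
    by rewrite expr0n muln_eq0 /= -[s == _]negbK -lt0n s_gt0 size_poly0.
  apply: size_le_of_eventually_le; first exact: lead_coef_even_power.
  by exists M => t /main [h _]; rewrite horner_exp.
have [->|n0] := eqVneq (oc N u (b j)) 0.
  by rewrite expr0n muln_eq0 /= -[s == _]negbK -lt0n s_gt0 mul0r size_poly0.
apply: size_le_of_eventually_le.
  by rewrite lead_coefM mulr_gt0 ?lead_coef_even_power // lead_coef_exp exprn_gt0.
by exists M => t /main [_ h]; rewrite hornerM !horner_exp.
Qed.

Lemma eval2_eq0_of_eventually Q N u :
  eventually (fun t => eval2 Q (sg * t) (ta * u * t ^+ N) = 0) -> oc N u Q = 0.
Proof.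
move=> [M HM]; apply: poly_eq0_of_eventually; exists M => t /HM.
by rewrite horner_on_curve.
Qed.

(** Where [F > 0], both [v] and [- v] may be used; adding and subtracting the two equations
    separates [A] from [C]. *)
Lemma sqrt_split A C N u : 0 < lead_coef (oc N u F) ->
  (forall x y v, v ^+ 2 = eval2 F x y -> eval2 A x y + v * eval2 C x y = 0) ->
  oc N u A = 0 /\ oc N u C = 0.
Proof.
move=> lF H; have [M HM] := eventually_gt0 lF.
split; apply: eval2_eq0_of_eventually; exists M => t /HM;
  rewrite !horner_on_curve //;
  set x := sg * t; set y := ta * u * t ^+ N => F0;
  pose v := Num.sqrt (eval2 F x y);
  have hv : v ^+ 2 = eval2 F x y by [rewrite sqr_sqrtr // ltW];
  have hv' : (- v) ^+ 2 = eval2 F x y by [rewrite sqrrN];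
  have h1 := H _ _ _ hv; have h2 := H _ _ _ hv'.
  lra.
have v0 : v != 0 by rewrite gt_eqF // sqrtr_gt0.
apply: (mulfI v0); lra.
Qed.

(* On the curve p = 0 the sum equals 1 while F tends to infinity, so each
   a_j is bounded, hence constant there, and each b_j vanishes. *)
Lemma components_mod_curve_eq l (a b : 'I_l -> B) G N :
  sqrt_power_sum F (2 * s) a b (1 + curve_eq sg ta N ^+ (2 * s) * G) ->
  0 < lead_coef (oc N 1 F) -> (1 < size (oc N 1 F))%N -> forall j,
  exists cab : R * B * B, a j = cab.1.1%:P%:P + curve_eq sg ta N * cab.1.2 /\
                          b j = curve_eq sg ta N * cab.2.
Proof.
move=> H lF sF j.
have [] := size_components_le H lF j.
rewrite on_curveD on_curve1 on_curveM on_curveX on_curve_curve_eq // expr0n.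
rewrite muln_eq0 /= -[s == _]negbK -lt0n s_gt0 mul0r addr0 size_poly1 => ha hb.
have {}ha : (size (oc N 1 (a j)) <= 1)%N.
  have [->|n0] := eqVneq (oc N 1 (a j)) 0; first by rewrite size_poly0.
  by have := size_exp_mul_le n0 ha; move: s_gt0; size_nia.
have {}hb : oc N 1 (b j) = 0.
  (* A nonzero [b_j] would make [b_j ^+ (2 * s) * F ^+ s] nonconstant on the curve, against the
     bound [hb]. *)
  apply/eqP/negPn/negP => n0.
  have F0 : oc N 1 F != 0 by rewrite -size_poly_gt0 ltnW.
  have := size_exp (oc N 1 F) s.
  move: hb; rewrite size_mul ?expf_neq0 //.
  have : (0 < size (oc N 1 (b j) ^+ (2 * s)))%N by rewrite size_poly_gt0 expf_neq0.
  have : (0 < size (oc N 1 F ^+ s))%N by rewrite size_poly_gt0 expf_neq0.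
  by move: sF s_gt0; size_nia.
have [a' Ha] := curve_eq_dvd sg2 (size1_polyC ha).
have [b' Hb] := @curve_eq_dvd _ _ ta sg2 N (b j) 0 hb.
by exists ((oc N 1 (a j))`_0, a', b'); split => //; rewrite Hb !polyC0 add0r.
Qed.

(* The rows of W are independent linear relations satisfied by the summands; they
   make the induction on n possible. *)
Definition needs_many (n : nat) G := forall l (a b : 'I_l -> B) r (W : 'M[R]_(r, l)),
  sqrt_power_sum F (2 * s) a b G -> row_free W ->
  (forall i, \sum_j (W i j)%:P%:P * a j = 0) ->
  (forall i, \sum_j (W i j)%:P%:P * b j = 0) -> (n + r <= l)%N.

Lemma needs_many0 G : needs_many 0 G.
Proof. by move=> l a b r W _ rW _ _; have := rank_leq_col W; rewrite (eqP rW). Qed.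

Lemma curve_eq_neq0 N : curve_eq sg ta N != 0.
Proof. by rewrite monic_neq0 // monicXsubC. Qed.

(** Restriction to [p = 0] leaves the relation between the constants; what remains is divisible by
    [p], which is cancelled. *)
Lemma relation_mod_curve_eq l (w c : 'I_l -> R) (a' : 'I_l -> B) N :
  \sum_j (w j)%:P%:P * ((c j)%:P%:P + curve_eq sg ta N * a' j) = 0 ->
  \sum_j w j * c j = 0 /\ \sum_j (w j)%:P%:P * a' j = 0.
Proof.
under eq_bigr => j _ do rewrite mulrDr mulrCA -!polyCM.
rewrite big_split /= -mulr_sumr -!rmorph_sum /= => h.
have c0 : \sum_j w j * c j = 0.
  have := congr1 (oc N 1) h; rewrite on_curveD on_curveC on_curveM.
  by rewrite on_curve_curve_eq mul0r addr0 on_curve0 => /eqP; rewrite polyC_eq0 => /eqP.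
split=> //; apply: (mulfI (curve_eq_neq0 N)).
by move: h; rewrite c0 !polyC0 add0r mulr0.
Qed.

(** The rows of [W] annihilate [c] and [w] does not, so [w] is outside their span. *)
Lemma row_free_add_row (r l : nat) (W : 'M[R]_(r, l)) (w : 'rV_l) (c : 'cV_l) :
  row_free W -> W *m c = 0 -> w *m c != 0 -> row_free (col_mx W w).
Proof.
move=> rW Wc wc; apply: inj_row_free => v.
rewrite -[v]hsubmxK mul_row_col; set v1 := lsubmx v; set v2 := rsubmx v => h.
have v20 : v2 = 0.
  have := congr1 (mulmx^~ c) h; rewrite mulmxDl -!mulmxA Wc mulmx0 add0r mul0mx.
  rewrite [v2]mx11_scalar [w *m c]mx11_scalar -scalar_mxM.
  move/matrixP/(_ 0 0); rewrite !mxE /= !mulr1n => /eqP; rewrite mulf_eq0.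
  case/orP => /eqP hz; first by rewrite hz raddf0.
  by case/negP: wc; rewrite [w *m c]mx11_scalar !mxE hz raddf0.
move: h; rewrite v20 mul0mx addr0 => h.
suff -> : v1 = 0 by rewrite row_mx0.
by apply: (row_free_inj rW); rewrite h mul0mx.
Qed.

(** For [k] nonzero, [a + P k] has degree [N + size k - 1]; multiplying by [2 * s] and cancelling
    [2 * s * N] bounds [size k] independently of [N]. *)
Lemma size_cofactor_le (N g : nat) (P k : {poly R}) (a : R) : size P = N.+1 ->
  (0 < N)%N -> (size ((a%:P + P * k) ^+ (2 * s)) <= 2 * s * N + g)%N ->
  (size k <= g.+1)%N.
Proof.
move=> sP N0; have [->|k0] := eqVneq k 0; first by rewrite size_poly0.
have P0 : P != 0 by rewrite -size_poly_gt0 sP.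
have sPk : size (P * k) = (N + size k)%N by rewrite size_mul // sP.
have k1 : (0 < size k)%N by rewrite size_poly_gt0.
have sk : size (a%:P + P * k) = (N + size k)%N.
  rewrite addrC size_polyDl // sPk; apply: leq_ltn_trans (size_polyC_leq1 _) _.
  by move: N0 k1; size_lia.
have n0 : a%:P + P * k != 0 by rewrite -size_poly_gt0 sk addn_gt0 N0.
move=> /(size_exp_mul_le n0); rewrite sk.
by move: s_gt0 k1 N0; size_nia.
Qed.

(* Comparing the expansion of \sum_j (c_j + p (a'_j + b'_j sqrt F))^(2s) with
   1 + p^(2s) G digit by digit in base p. *)
Lemma compare_digits l (c : 'I_l -> R) (a' b' : 'I_l -> B) G (N0 N g e : nat) :
  (N0 < N)%N -> (2 * s * (g + e) + 1 <= N)%N ->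
  (forall u, 0 < u -> 0 < lead_coef (oc N0 u F)) ->
  (forall u j, 0 < u -> (size (oc N0 u (a' j)) <= g)%N) ->
  (forall u j, 0 < u -> (size (oc N0 u (b' j)) <= g)%N) ->
  (forall u, (size (oc N0 u F) <= e)%N) -> (forall u, (size (oc N0 u G) <= g)%N) ->
  let p := curve_eq sg ta N in
  sqrt_power_sum F (2 * s) (fun j => (c j)%:P%:P + p * a' j) (fun j => p * b' j)
    (1 + p ^+ (2 * s) * G) ->
  let A m := \sum_j (c j ^+ (2 * s - m) *+ 'C(2 * s, m))%:P%:P *
                    (sqrt_pow F (a' j) (b' j) m).1 in
  let C m := \sum_j (c j ^+ (2 * s - m) *+ 'C(2 * s, m))%:P%:P *
                    (sqrt_pow F (a' j) (b' j) m).2 in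
  forall m, (m < (2 * s).+1)%N ->
    A m = (if m == 0%N then 1 else 0) + (if m == (2 * s)%N then G else 0) /\ C m = 0.
Proof.
move=> N0N Nbig lF sa sb sF sG p H A C.
(* [E m] is the difference of the [m]-th digits of the two sides. *)
pose E m := A m - (if m == 0%N then 1 else 0) - (if m == (2 * s)%N then G else 0).
have sumE : \sum_(m < (2 * s).+1) p ^+ m * E m =
   \sum_(m < (2 * s).+1) p ^+ m * A m - (1 + p ^+ (2 * s) * G).
  under eq_bigr => m _ do rewrite !mulrBr.
  rewrite !sumrB opprD addrA; congr (_ - _ - _).
    rewrite (bigD1 ord0) //= mulr1 big1 ?addr0 // => i.
    by rewrite -val_eqE /= => /negbTE ->; rewrite mulr0.
  rewrite (bigD1 ord_max) //= eqxx big1 ?addr0 // => i.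
  by rewrite -val_eqE /= => /negbTE ->; rewrite mulr0.
(* Binomial expansion in [p], with the sums over [j] and [m] exchanged. *)
have key x y v : v ^+ 2 = eval2 F x y ->
    eval2 (\sum_(m < (2 * s).+1) p ^+ m * E m) x y +
    v * eval2 (\sum_(m < (2 * s).+1) p ^+ m * C m) x y = 0.
  move=> hv; have := H _ _ _ hv.
  rewrite sumE eval2B; move=> <-; rewrite addrAC; apply/eqP; rewrite subr_eq0; apply/eqP.
  rewrite !eval2_sum mulr_sumr -big_split /=.
  under [RHS]eq_bigr => j _ do
    rewrite eval2D !eval2M eval2_const (mulrCA v) -addrA -mulrDr exprDn.
  rewrite exchange_big /=; apply: eq_bigr => m _.
  rewrite !eval2M (mulrCA v) -mulrDr !eval2_sum mulr_sumr -big_split mulr_sumr /=.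
  apply: eq_bigr => j _.
  rewrite !eval2M eval2_const eval2X exprMn -(eval2_sqrt_pow _ _ _ hv).
  by rewrite (mulrCA v) -mulrDr [in RHS]mulrCA mulrnAl mulrnAr.
(* Along the curves of exponent [N0], [p] has degree exactly [N], while the digits have size at most
   [N]. *)
have small u m : 0 < u -> (m < (2 * s).+1)%N ->
    (size (oc N0 u (E m)) < size (oc N0 u p))%N /\
    (size (oc N0 u (C m)) < size (oc N0 u p))%N.
  move=> u0 ms; rewrite size_on_curve_curve_eq // !ltnS.
  have mb : (m * (g + e) + 1 <= N)%N.
    by apply: leq_trans Nbig; rewrite leq_add2r leq_mul2r -ltnS ms orbT.
  have sp j := size_on_curve_sqrt_pow m (sa u j u0) (sb u j u0) (sF u).
  have scst (z : R) (Q : B) :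
      (size (oc N0 u Q) <= m * (g + e) + 1)%N -> (size (oc N0 u (z%:P%:P * Q)) <= N)%N.
    move=> hQ; rewrite on_curveM on_curveC mul_polyC.
    by apply: leq_trans (size_scale_leq _ _) _; apply: leq_trans hQ mb.
  have ssum (f : 'I_l -> B) : (forall j, (size (oc N0 u (f j)) <= N)%N) ->
      (size (oc N0 u (\sum_j f j)) <= N)%N.
    move=> hf; rewrite on_curve_sum; apply: leq_trans (size_sum _ _ _) _.
    by apply/bigmax_leqP.
  split; last by apply: ssum => j; apply: scst; case: (sp j).
  rewrite !on_curveB; apply: leq_trans (size_polyD _ _) _; rewrite geq_max.
  rewrite size_polyN; apply/andP; split.
    apply: leq_trans (size_polyD _ _) _; rewrite geq_max size_polyN; apply/andP; split.
      by apply: ssum => j; apply: scst; case: (sp j).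
    case: ifP => _; rewrite ?on_curve1 ?on_curve0 ?size_poly0 // size_poly1.
    by apply: leq_ltn_trans N0N.
  case: ifP => _; rewrite ?on_curve0 ?size_poly0 //.
  by apply: leq_trans (sG u) _; move: Nbig s_gt0; clear; nia.
(* Uniqueness of digits holds on each curve; a polynomial vanishing on all of them is zero. *)
have digits (D : nat -> B) :
    (forall u, 0 < u -> oc N0 u (\sum_(m < (2 * s).+1) p ^+ m * D m) = 0) ->
    (forall u m, 0 < u -> (m < (2 * s).+1)%N ->
      (size (oc N0 u (D m)) < size (oc N0 u p))%N) ->
    forall m, (m < (2 * s).+1)%N -> D m = 0.
  move=> h1 h2 m ms; apply: (on_curve_injective sg2 ta2 (N := N0)) => u u0.
  apply: (digits_eq0 (p := oc N0 u p) (e := fun m => oc N0 u (D m)) _ _ ms).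
    by move=> k kM; apply: h2.
  by rewrite -[RHS](h1 u u0) on_curve_sum; apply: eq_bigr => i _; rewrite on_curveM on_curveX.
move=> m ms.
have split0 u (u0 : 0 < u) := sqrt_split (lF u u0) key.
split.
  have : E m = 0.
    by apply: digits ms => u; [case/split0 | move=> k u0 /(small u k u0) []].
  by rewrite /E => /eqP; rewrite -addrA -opprD subr_eq0 => /eqP ->.
by apply: digits ms => u; [case/split0 | move=> k u0 /(small u k u0) []].
Qed.

End Step.

(** * Induction on the number of summands *)

Section Induction.
Variable R : rcfType.
Local Notation B := {poly {poly R}}.
Variables sg ta : R.
Hypotheses (sg2 : sg * sg = 1) (ta2 : ta * ta = 1).
Local Notation oc := (on_curve sg ta).
Variable F : B.
Hypothesis F_nonconst : ~ exists c : R, F = c%:P%:P.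
Hypothesis F_lead :
  0 < lead_coef (lead_coef F) * sg ^+ (size (lead_coef F)).-1 * ta ^+ (size F).-1.
Variable s : nat.
Hypothesis s_gt0 : (0 < s)%N.

Lemma size_one_add_mul_le (p G : {poly R}) (N g : nat) : size p = N.+1 ->
  (size G <= g)%N -> (size (1 + p ^+ (2 * s) * G)%R <= 2 * s * N + g.+1)%N.
Proof.
move=> sp sG; apply: leq_trans (size_polyD _ _) _; rewrite geq_max size_poly1 addnS /=.
apply: leq_trans (size_polyMleq _ _) _.
have p0 : p != 0 by rewrite -size_poly_gt0 sp.
have := size_exp p (2 * s); rewrite sp /= (mulnC N) => <-.
have : (0 < size (p ^+ (2 * s)))%N by rewrite size_poly_gt0 expf_neq0.
by move: sG; size_lia.
Qed.

(** The cofactors represent [G] and inherit the relations [W]. Digit 1 gives them one more relation,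
    so the induction hypothesis is applied with [r + 1] rows. *)
Lemma needs_manyS n G : needs_many F s n G ->
  exists N, needs_many F s n.+1 (1 + curve_eq sg ta N ^+ (2 * s) * G).
Proof.
move=> IH.
have [N0 HN0] := on_curve_leading sg2 ta2 F_nonconst F_lead.
have [g Hg] := size_on_curve_bounded ta sg2 N0 G.
have [e He] := size_on_curve_bounded ta sg2 N0 F.
(* [g.+2] will bound the cofactors of any representation, so [N] can be fixed before the
   representation is given; the remaining terms ensure [N0 < N]. *)
pose N := (N0 + 2 * s * (g.+2 + e) + 1)%N.
exists N => l a b r W H rW Wa Wb; set p := curve_eq sg ta N in H.
have N0N : (N0 < N)%N by rewrite /N; lia.
have [lF1 sF1] := HN0 N 1 (ltnW N0N) ltr01.
have [f Hf] := fin_all_exists (components_mod_curve_eq sg2 s_gt0 H lF1 sF1).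
pose c j := (f j).1.1; pose a' j := (f j).1.2; pose b' j := (f j).2.
have Ha j : a j = (c j)%:P%:P + p * a' j by case: (Hf j).
have Hb j : b j = p * b' j by case: (Hf j).
have H' : sqrt_power_sum F (2 * s) (fun j => (c j)%:P%:P + p * a' j)
    (fun j => p * b' j) (1 + p ^+ (2 * s) * G).
  by move=> x y v /H <-; apply: eq_bigr => j _; rewrite Ha Hb.
have lF u : 0 < u -> 0 < lead_coef (oc N0 u F) by case/(HN0 _ _ (leqnn _)).
have sp u : size (oc N0 u p) = N.+1 by rewrite size_on_curve_curve_eq.
have N_gt0 : (0 < N)%N by apply: leq_ltn_trans N0N.
have bnd u : (size (oc N0 u (1 + p ^+ (2 * s) * G)%R) <= 2 * s * N + g.+1)%N.
  by rewrite on_curveD on_curve1 on_curveM on_curveX size_one_add_mul_le.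
have sa u j : 0 < u -> (size (oc N0 u (a' j)) <= g.+2)%N.
  move=> u0; have [h _] := size_components_le sg2 s_gt0 H' (lF u u0) j.
  apply: (size_cofactor_le s_gt0 (a := c j) (sp u) N_gt0).
  by apply: leq_trans (bnd u); rewrite on_curveD on_curveC on_curveM in h.
have sb u j : 0 < u -> (size (oc N0 u (b' j)) <= g.+2)%N.
  move=> u0; have [_ h] := size_components_le sg2 s_gt0 H' (lF u u0) j.
  apply: (size_cofactor_le s_gt0 (a := 0) (sp u) N_gt0).
  apply: leq_trans (bnd u); apply: leq_trans h; rewrite polyC0 add0r on_curveM.
  have Fs0 : oc N0 u F ^+ s != 0.
    by rewrite expf_neq0 // -lead_coef_eq0 gt_eqF // lF.
  move: Fs0; set T := oc N0 u F ^+ s; set Q := (oc N0 u p * _) ^+ _ => T0.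
  have [->|Q0] := eqVneq Q 0; first by rewrite mul0r size_poly0.
  rewrite size_mul //; move: T0; rewrite -size_poly_gt0.
  by case: (size T) => // k _; rewrite addnS leq_addr.
have Nbig : (2 * s * (g.+2 + e) + 1 <= N)%N by rewrite /N; lia.
have D := compare_digits sg2 ta2 s_gt0 N0N Nbig lF sa sb He
  (fun u => leq_trans (Hg u) (leqW (leqnSn g))) H'.
have s20 : (2 * s)%N == 0%N = false by apply/negbTE; rewrite -lt0n muln_gt0.
have s21 : (1%N == (2 * s)%N) = false by apply/negbTE/eqP; lia.
have [D0 _] := D 0%N isT.
have lt1 : (1 < (2 * s).+1)%N by rewrite ltnS muln_gt0.
have [D1 D1'] := D 1%N lt1.
have [D2 D2'] := D (2 * s)%N (ltnSn _).
have csum : \sum_j c j ^+ (2 * s) = 1.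
  move: D0; rewrite /= eq_sym s20 addr0 => /(congr1 (fun q => eval2 q 0 0)).
  rewrite eval2_sum eval2_const => <-; apply: eq_bigr => j _.
  by rewrite eval2M !eval2_const mulr1 subn0 bin0.
(* The coefficients of the relation given by digit 1. *)
pose w : 'rV[R]_l := \row_j (c j ^+ (2 * s - 1) *+ 'C(2 * s, 1)).
pose cv : 'cV[R]_l := \col_j c j.
have Wa' i : \sum_j W i j * c j = 0 /\ \sum_j (W i j)%:P%:P * a' j = 0.
  apply: (relation_mod_curve_eq (N := N)); rewrite -[RHS](Wa i).
  by apply: eq_bigr => j _; rewrite Ha.
have Wb' i : \sum_j (W i j)%:P%:P * b' j = 0.
  apply: (mulfI (curve_eq_neq0 sg ta N)); rewrite mulr0 -[RHS](Wb i) mulr_sumr.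
  by apply: eq_bigr => j _; rewrite Hb mulrCA.
have rW' : row_free (col_mx W w).
  apply: (row_free_add_row (c := cv)) => //.
    apply/matrixP => i k; rewrite !mxE; case: (Wa' i) => h _; rewrite -[RHS]h.
    by apply: eq_bigr => j _; rewrite mxE.
  (* The product of [w] and [cv] is [2 * s] times the sum of the [c_j ^+ (2 * s)], that is [2 * s],
     which is nonzero. *)
  apply/eqP => /matrixP /(_ 0 0); rewrite !mxE.
  under eq_bigr => j _ do rewrite !mxE bin1 mulrnAl -exprSr subn1 prednK ?muln_gt0 //.
  by rewrite sumrMnl csum => /eqP; rewrite pnatr_eq0 s20.
have -> : (n.+1 + r = n + (r + 1))%N by lia.
apply: (IH l a' b' _ (col_mx W w)) => //.
(* In digit [2 * s] the binomial coefficient and the power of [c_j] are both 1, so this digit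
   represents [G]. *)
- move=> x y v hv; move: D2 D2'; rewrite /= s20 eqxx add0r => D2 D2'.
  have eA := congr1 (fun q => eval2 q x y) D2.
  have eC := congr1 (fun q => eval2 q x y) D2'.
  have e0 : eval2 (0 : B) x y = 0 by rewrite /eval2 !horner0.
  rewrite -[RHS]addr0 -[X in _ = _ + X](mulr0 v) -[in RHS]e0 -[eval2 G x y]eA -[eval2 0 x y]eC.
  rewrite !eval2_sum mulr_sumr -big_split /=; apply: eq_bigr => j _.
  by rewrite !eval2M eval2_const subnn binn mulr1n expr0 !mul1r eval2_sqrt_pow.
- move=> i; rewrite -(splitK i); case: (split i) => k /=.
    case: (Wa' k) => _ h; rewrite -[RHS]h.
    by apply: eq_bigr => j _; rewrite col_mxEu.
  move: D1; rewrite /= s21 addr0 => h; rewrite -[RHS]h.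
  by apply: eq_bigr => j _; rewrite col_mxEd mxE mulr1 !mulr0 addr0.
- move=> i; rewrite -(splitK i); case: (split i) => k /=.
    by rewrite -[RHS](Wb' k); apply: eq_bigr => j _; rewrite col_mxEu.
  rewrite -[RHS]D1'.
  by apply: eq_bigr => j _; rewrite col_mxEd mxE /= mulr0 mulr1 add0r.
Qed.

Lemma exists_needs_many n : exists qs : seq B, 
  needs_many F s n (\sum_(q <- qs) q ^+ (2 * s)).
Proof.
elim: n => [|n [qs /needs_manyS [N HN]]]; first by exists [::]; exact: needs_many0.
exists (1 :: [seq curve_eq sg ta N * q | q <- qs]).
rewrite big_cons big_map expr1n.
by under eq_bigr => q _ do rewrite exprMn; rewrite -mulr_sumr.
Qed.

End Induction.

(** * Choice of signs, change of variables and passage to the quotient ring *)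

Section Transfer.
Variable R : realType.
Local Notation B := (bipoly R).

(** If [alpha F] is negative, strict admissibility provides an odd exponent, and the sign of that
    variable is flipped. *)
Lemma leading_sign (F : B) : strictly_admissible F ->
  exists sg ta : R, [/\ sg * sg = 1, ta * ta = 1 &
  0 < lead_coef (lead_coef F) * sg ^+ (size (lead_coef F)).-1 * ta ^+ (size F).-1].
Proof.
move=> [nc [_ adm]].
have a0 : alpha F != 0.
  rewrite !lead_coef_eq0; apply/eqP => h; apply: nc.
  by exists 0; rewrite h /cstP !polyC0.
have sgn n : odd n -> (-1) ^+ n = -1 :> R by move=> h; rewrite -signr_odd h expr1.
have NN : (-1) * (-1) = 1 :> R by rewrite mulrNN mulr1.
have [apos|aneg|/eqP] := ltgtP 0 (alpha F); last by rewrite eq_sym (negbTE a0).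
  by exists 1, 1; rewrite !expr1n !mulr1.
case: adm => [[]|[ob|od]]; first by rewrite ltNge (ltW aneg).
  by exists (-1), 1; rewrite (sgn _ ob) expr1n; split=> //;
    [ring | move: aneg; rewrite /alpha; lra].
by exists 1, (-1); rewrite (sgn _ od) expr1n; split=> //;
  [ring | move: aneg; rewrite /alpha; lra].
Qed.

(** Surjectivity lets the polynomials built after the substitution be pulled back. The linear forms
    with coefficients from the rows of [invmx M] are sent to [x] and [y], so the image contains all
    generators. *)
Lemma compM_morphism (M : 'M[R]_2) : M \in unitmx ->
  exists phi : {rmorphism B -> B}, (forall g, compM g M = phi g) /\
    (forall g, exists h, phi h = g).
Proof.
move=> uM.
pose L1 : B := cstP (M 0 0) * @xP R + cstP (M 0 1) * @yP R.
pose L2 : B := cstP (M 1 0) * @xP R + cstP (M 1 1) * @yP R.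
have [cst cstE] : exists cst : {rmorphism R -> B}, forall c, cst c = cstP c.
  by exists (polyC \o polyC)%FUN.
have [phi1 phi1E] : exists phi1 : {rmorphism {poly R} -> B},
    forall q, phi1 q = (map_poly (@cstP R) q).[L1].
  exists (horner_eval L1 \o map_poly cst) => q /=.
  by congr _.[_]; apply: eq_map_poly.
have [phi phiE] : exists phi : {rmorphism B -> B}, forall q, phi q = (map_poly phi1 q).[L2].
  by exists (horner_eval L2 \o map_poly phi1).
exists phi; split=> g.
  by rewrite phiE /compM; congr _.[_]; apply: eq_map_poly => q; rewrite phi1E.
have map_cst q : map_poly (@cstP R) q = map_poly cst q.
  by apply: eq_map_poly.
have phi1C c : phi1 c%:P = cstP c.
  by rewrite phi1E map_cst map_polyC hornerC; exact: cstE.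
have phi1X : phi1 'X = L1 by rewrite phi1E map_cst map_polyX hornerX.
have phic c : phi (cstP c) = cstP c.
  by rewrite phiE /cstP map_polyC hornerC; exact: phi1C.
have phix : phi (@xP R) = L1 by rewrite phiE /xP map_polyC hornerC; exact: phi1X.
have phiy : phi (@yP R) = L2 by rewrite phiE /yP map_polyX hornerX.
have VM i j : (invmx M *m M) i j = (i == j)%:R by rewrite mulVmx // mxE.
have entry i j : invmx M i 0 * M 0 j + invmx M i 1 * M 1 j = (i == j)%:R.
  have -> : 1 = lift ord0 ord0 :> 'I_2 by apply: val_inj.
  by rewrite -VM mxE big_ord_recl big_ord1.
have im i : phi (cstP (invmx M i 0) * @xP R + cstP (invmx M i 1) * @yP R) =
    cstP (i == 0)%:R * @xP R + cstP (i == 1)%:R * @yP R.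
  rewrite rmorphD !rmorphM !phic phix phiy -!entry /cstP !polyCD !polyCM /L1 /L2 /cstP.
  ring.
have hx : exists h, phi h = @xP R.
  by eexists; apply: etrans (im 0) _; rewrite /cstP /= !polyC0 mul0r addr0 !polyC1 mul1r.
have hy : exists h, phi h = @yP R.
  by eexists; apply: etrans (im 1) _; rewrite /cstP /= !polyC0 mul0r add0r !polyC1 mul1r.
case: hx => x' hx; case: hy => y' hy.
elim/poly_ind: g => [|g q [g' hg]]; first by exists 0; rewrite rmorph0.
suff [q' hq] : exists q', phi q' = q%:P.
  by exists (g' * y' + q'); rewrite rmorphD rmorphM hg hy hq.
elim/poly_ind: q => [|q c [q' hq]]; first by exists 0; rewrite rmorph0.
exists (q' * x' + cstP c); rewrite rmorphD rmorphM hq hx phic.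
by rewrite /xP /cstP -polyCM -polyCD.
Qed.

(** Horner's rule with [z ^ 2] replaced by [F]: [(a + b z) z + c = (F b + c) + a z]. *)
Lemma sqrt_components (F : B) (H : tripoly R) : exists ab : B * B,
  forall x y v, v ^+ 2 = eval2 F x y ->
    eval2 H.[v%:P%:P] x y = eval2 ab.1 x y + v * eval2 ab.2 x y.
Proof.
elim/poly_ind: H => [|H c [[a b] IH]].
  by exists (0, 0) => x y v _; rewrite /eval2 !horner0 mulr0 addr0.
exists (F * b + c, a) => x y v hv.
rewrite hornerMXaddC !(eval2D, eval2M) eval2_const (IH _ _ _ hv) -hv /=.
ring.
Qed.

End Transfer.

Theorem mainTheorem7 (R : realType) (f : bipoly R) (s : nat) :
  admissible f ->
  ~ (exists g : bipoly R, f = g ^+ 2) ->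
  (1 <= s)%N ->
  pythagoras_infinite f (2 * s).
Proof.
move=> [M [uM sadm]] _ s_gt0 [l [_ Hl]].
have [phi [phiE phi_surj]] := compM_morphism uM.
have [sg [ta [sg2 ta2 F_lead]]] := leading_sign sadm.
have F_nonconst : ~ exists c : R, compM f M = c%:P%:P by case: sadm.
have [qs Hqs] := exists_needs_many sg2 ta2 F_nonconst F_lead s_gt0 l.+1.
have [qs' phi_qs'] : exists qs', map phi qs' = qs.
  elim: qs {Hqs} => [|q qs [qs' <-]]; first by exists [::].
  by have [q' <-] := phi_surj q; exists (q' :: qs').
(* The pulled-back sum of powers lies in [R[x,y]], so the supposed bound [l] applies to it. *)
have /Hl [hs [size_hs [h Hh]]] :
    sum_of_powers f (2 * s) (\sum_(q <- qs') q ^+ (2 * s))%:P.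
  exists (map polyC qs'), 0; rewrite mul0r big_map rmorph_sum /=.
  by apply/eqP; rewrite subr_eq0; apply/eqP/eq_bigr => q _; rewrite polyC_exp.
pose hs_ (j : 'I_(size hs)) := map_poly phi hs`_j.
have [ab Hab] := fin_all_exists (fun j => sqrt_components (compM f M) (hs_ j)).
suff : (l.+1 + 0 <= size hs)%N by rewrite addn0 ltnNge size_hs.
apply: (Hqs _ (fun j => (ab j).1) (fun j => (ab j).2) 0%N 0) => //.
- move=> x y v hv.
  under eq_bigr => j _ do rewrite -Hab //.
  (* Applying [phi] to the coefficients and setting [z = v] turns [z ^ 2 - f] into zero, which
     removes the multiple [h]. *)
  have := congr1 (fun P : tripoly R => eval2 (map_poly phi P).[v%:P%:P] x y) Hh.
  rewrite rmorphB rmorphM rmorphB /= !map_polyC /= rmorphXn /= map_polyX -(phiE f).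
  rewrite !(hornerD, hornerN, hornerM, hornerC, horner_exp, hornerX).
  rewrite !(eval2D, eval2M) !eval2N eval2_const -expr2 hv subrr mulr0.
  move=> /eqP; rewrite subr_eq0 => /eqP; rewrite -phi_qs' big_map.
  have <- : phi (\sum_(q <- qs') q ^+ (2 * s)) = \sum_(q <- qs') phi q ^+ (2 * s).
    by rewrite rmorph_sum; apply: eq_bigr => q _; rewrite rmorphXn.
  move=> ->.
  rewrite rmorph_sum horner_sum eval2_sum (big_nth 0) big_mkord.
  by apply: eq_bigr => j _; rewrite rmorphXn horner_exp eval2X.
- by rewrite /row_free mxrank0.
- by case.
- by case.
Qed.
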